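(* Let $k\ge 2$ and let $\mathcal{T}$ be the set of all small subsets of $V(G_k)$. Then $\mathcal{T}$ is an $\operatorname{mm}$-tangle of order $k$ in $G_k$, i.e.: (T1) for every $S\subseteq V(G_k)$ with $\operatorname{mm}(S)\le k-1$, one of $S$ and $V(G_k)\setminus S$ is in $\mathcal{T}$; (T2) for all $S_1,S_2,S_3\in\mathcal{T}$, $S_1\cup S_2\cup S_3\ne V(G_k)$; (T3) for every $x\in V(G_k)$, $V(G_k)\setminus\{x\}\notin\mathcal{T}$.
   Context: $G_k$ is the $k\times k$-grid with vertex set $\{(i,j):1\le i,j\le k\}$ and edges $(i,j)(i',j')$ with $|i-i'|+|j-j'|=1$. $R_j=\{(i,j):1\le i\le k\}$ is the $j$-th row. For $X\subseteq V(G_k)$, $\operatorname{mm}(X)$ is the size of a maximum matching in $G_k$ among the edges with one end in $X$ and the other in $V(G_k)\setminus X$. A set $X\subseteq V(G_k)$ is small if $\operatorname{mm}(X)<k$ and $R_i\not\subseteq X$ for all $i=1,\dots,k$. *)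

(* Defs.v *)
From mathcomp Require Import all_boot all_order all_algebra.

Set Implicit Arguments.
Unset Strict Implicit.
Unset Printing Implicit Defensive.

Section Graph.
Variables (T : finType) (e : rel T).

(* Meant for symmetric irreflexive e; an edge is its set of two ends. *)
Definition cut_edges (X : {set T}) : {set {set T}} :=
  [set [set p.1; p.2] | p : T * T & [&& e p.1 p.2, p.1 \in X & p.2 \notin X]].

Definition matching (M : {set {set T}}) : bool := trivIset M.

Definition max_cut_matching (X : {set T}) : nat :=
  \max_(M : {set {set T}} | (M \subset cut_edges X) && matching M) #|M|.

End Graph.

Record tangle (T : finType) (f : {set T} -> nat) (k : nat)
    (TT : {set {set T}}) : Prop := Tangle {
  tangle_T1 : forall S : {set T}, f S <= k - 1 -> S \in TT \/ ~: S \in TT;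
  tangle_T2 : forall S1 S2 S3 : {set T},
    S1 \in TT -> S2 \in TT -> S3 \in TT -> S1 :|: S2 :|: S3 != [set: T];
  tangle_T3 : forall x : T, ~: [set x] \notin TT
}.

Section Grid.
Variable k : nat.

(* Coordinates run over 0, ..., k-1 instead of 1, ..., k. *)
Definition grid_vertex : finType := ('I_k * 'I_k)%type.

Definition grid_adj : rel grid_vertex :=
  fun u v => `|u.1 - v.1|%N + `|u.2 - v.2|%N == 1.

(* The second coordinate is the fixed one. *)
Definition grid_row (j : 'I_k) : {set grid_vertex} := [set v | v.2 == j].

Definition mm (X : {set grid_vertex}) : nat := max_cut_matching grid_adj X.

Definition small (X : {set grid_vertex}) : bool :=
  (mm X < k) && [forall j : 'I_k, ~~ (grid_row j \subset X)].

Definition small_sets : {set {set grid_vertex}} := [set X | small X].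

End Grid.

(* Main.v *)
(* By Koenig's theorem, mm S < k means that some set C of fewer than k vertices
   covers all edges leaving S. A column avoiding C lies on one side of S, whence
   (T1); (T3) holds since V minus a vertex contains a row.

   For (T2), suppose three small sets X_i with covers C_i, all of size less than
   k, cover the grid, and delete the row 0 and a suitable column j, which makes
   the columns j-1 and j+1 adjacent. If C_i misses row 0 then so does X_i, and
   this happens for at most one i, since otherwise row 0 would lie in the third
   set; for this i let j be the column of a vertex c of C_i in the topmost row
   hit by C_i. All vertices above c are outside X_i, so c is not needed to cover
   the new edge across column j. Hence each C_i loses a vertex, the X_i still
   contain no full row, and induction on k applies. *)
Require Import Defs.
From mathcomp Require Import all_boot all_order all_algebra.
From mathcomp Require Import zify.

Set Implicit Arguments.
Unset Strict Implicit.
Unset Printing Implicit Defensive.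

(** * König's theorem for bipartite graphs *)

Section Koenig.
Variables (E T : finType).
Implicit Types (H : {set E}) (A B : {set T}) (a b : E -> T).

(** The ends [a f] and [b f] of an edge are read in two separate copies of [T], which makes the
    graph bipartite. *)
Definition covers a b H A B := [forall f in H, (a f \in A) || (b f \in B)].

Definition cover_ge k a b H :=
  [forall A, forall B, covers a b H A B ==> (k <= #|A| + #|B|)].

Lemma coversP a b H A B :
  reflect (forall f, f \in H -> (a f \in A) || (b f \in B)) (covers a b H A B).
Proof. exact: (iffP forall_inP). Qed.

Lemma cover_geP k a b H :
  reflect (forall A B, covers a b H A B -> k <= #|A| + #|B|)
          (cover_ge k a b H).
Proof.
apply: (iffP forallP) => [h A B|h A].
  by have /forallP/(_ B)/implyP := h A.
by apply/forallP=> B; apply/implyP/h.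
Qed.

Lemma cover_ge_sym k a b H : cover_ge k a b H = cover_ge k b a H.
Proof.
wlog suff imp: a b / cover_ge k a b H -> cover_ge k b a H.
  by apply/idP/idP; apply: imp.
move=> /cover_geP h; apply/cover_geP=> A B /coversP AB; rewrite addnC.
by apply/h/coversP=> f /AB; rewrite orbC.
Qed.

(* The pairs (A1 :&: A2, B1 :|: B2) and (A1 :|: A2, B1 :&: B2) cover every edge
   covered by both (A1, B1) and (A2, B2), and have the same total size. *)
Lemma cover_critical_inj k a b H :
    cover_ge k a b H -> (forall f, f \in H -> ~~ cover_ge k a b (H :\ f)) ->
  {in H &, injective a}.
Proof.
move=> /cover_geP Hk crit f g fH gH eq_a; apply/eqP/negPn/negP=> fg.
have small_cover h : h \in H -> exists A, exists B,
    [/\ covers a b (H :\ h) A B, #|A| + #|B| < k, a h \notin A & b h \notin B].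
  move=> hH; have /forallPn[A /forallPn[B]] := crit _ hH.
  rewrite negb_imply -ltnNge => /andP[AB ltk]; exists A, B; split=> //.
    apply/negP=> hA; move: ltk; rewrite ltnNge Hk //; apply/coversP=> p pH.
    have [->|ph] := eqVneq p h; first by rewrite hA.
    by apply: (coversP _ _ _ _ _ AB); rewrite !inE ph.
  apply/negP=> hB; move: ltk; rewrite ltnNge Hk //; apply/coversP=> p pH.
  have [->|ph] := eqVneq p h; first by rewrite hB orbT.
  by apply: (coversP _ _ _ _ _ AB); rewrite !inE ph.
have [A1 [B1 [/coversP c1 k1 f1 f1']]] := small_cover _ fH.
have [A2 [B2 [/coversP c2 k2 g2 g2']]] := small_cover _ gH.
have gB1 : b g \in B1.
  by have := c1 g; rewrite !inE eq_sym fg gH -eq_a (negPf f1); apply.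
have fB2 : b f \in B2.
  by have := c2 f; rewrite !inE fg fH eq_a (negPf g2); apply.
have le1 : k <= #|A1 :&: A2| + #|B1 :|: B2|.
  apply/Hk/coversP=> p pH; rewrite !inE.
  have [->|pf] := eqVneq p f; first by rewrite fB2 !orbT.
  have [->|pg] := eqVneq p g; first by rewrite gB1 !orbT.
  have := c1 p; have := c2 p; rewrite !inE pf pg pH => /(_ isT) + /(_ isT).
  by do 4!case: (_ \in _).
(* Both [f] and [g] are missed by these sets; adding their common end [a f] costs one, and the sum
   of the bounds becomes [2k <= 2(k-1) + 1]. *)
have le2 : k <= #|a f |: (A1 :|: A2)| + #|B1 :&: B2|.
  apply/Hk/coversP=> p pH; rewrite !inE.
  have [->|pf] := eqVneq p f; first by rewrite eqxx.
  have [->|pg] := eqVneq p g; first by rewrite eq_a eqxx.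
  have := c1 p; have := c2 p; rewrite !inE pf pg pH => /(_ isT) + /(_ isT).
  by case: (_ == _) => //; do 4!case: (_ \in _).
have le3 : #|a f |: (A1 :|: A2)| <= (#|A1 :|: A2|).+1.
  by rewrite cardsU1; case: (_ \notin _).
have := cardsUI A1 A2; have := cardsUI B1 B2.
lia.
Qed.

(** A minimal subfamily still needing [k] cover vertices is critical, hence a matching; its left
    ends alone cover it, so it has at least [k] edges. *)
Lemma koenig k a b H : cover_ge k a b H ->
  exists M : {set E}, [/\ M \subset H, {in M &, injective a},
    {in M &, injective b} & k <= #|M|].
Proof.
move=> Hk.
have [M /minsetP[Mk Mmin] MH] := minset_exists (P := cover_ge k a b) Hk.
have crit f : f \in M -> ~~ cover_ge k a b (M :\ f).
  move=> fM; apply/negP=> /Mmin/(_ (subsetDl _ _)) eqM.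
  by move: fM; rewrite -eqM !inE eqxx.
exists M; split=> //; first exact: cover_critical_inj crit.
  apply: (@cover_critical_inj k b a); first by rewrite cover_ge_sym.
  by move=> f fM; rewrite cover_ge_sym crit.
have /cover_geP/(_ (a @: M) set0) := Mk; rewrite cards0 addn0 => le.
apply: leq_trans (leq_imset_card a M); apply: le.
by apply/coversP=> f fM; rewrite imset_f.
Qed.

End Koenig.

Lemma max_cut_matching_cover (T : finType) (e : rel T) (X : {set T}) k :
    max_cut_matching e X < k ->
  exists2 C : {set T}, #|C| < k &
    forall x y, e x y -> x \in X -> y \notin X -> (x \in C) || (y \in C).
Proof.
move=> ltk.
pose H := [set p : T * T | [&& e p.1 p.2, p.1 \in X & p.2 \notin X]].
have [/koenig[M [/subsetP MH inj1 inj2 kM]]|] := boolP (cover_ge k fst snd H).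
  pose ends (p : T * T) := [set p.1; p.2].
  (* First ends lie in [X] and second ends outside, so edges can only meet in ends of the same
     kind. *)
  have sepX p q : p \in M -> q \in M -> p.1 <> q.2.
    move=> /MH + /MH; rewrite !inE => /and3P[_ p1 _] /and3P[_ _ q2] eqpq.
    by rewrite -eqpq p1 in q2.
  have meet p q x : p \in M -> q \in M -> x \in ends p -> x \in ends q -> p = q.
    move=> pM qM; rewrite !inE => /orP[]/eqP-> /orP[]/eqP eqpq.
    - exact: inj1.
    - by case: (sepX p q).
    - by case: (sepX q p).
    - exact: inj2.
  have ends_inj : {in M &, injective ends}.
    move=> p q pM qM eqpq; apply: (meet _ _ p.1) => //; last rewrite -eqpq.
      by rewrite !inE eqxx.
    by rewrite !inE eqxx.
  move: ltk; rewrite ltnNge => /negP[]; apply: leq_trans kM _.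
  rewrite -(card_in_imset ends_inj); apply: leq_bigmax_cond.
  apply/andP; split.
    apply/subsetP=> _ /imsetP[p /MH pH ->]; apply: imset_f.
    by rewrite inE in pH *.
  apply/trivIsetP=> _ _ /imsetP[p pM ->] /imsetP[q qM ->] neq.
  apply/pred0P=> x /=; apply/negP=> /andP[xp xq]; case/negP: neq.
  by rewrite (meet p q x).
move/forallPn=> [A /forallPn[B]]; rewrite negb_imply -ltnNge.
move=> /andP[/coversP AB lt].
exists (A :|: B); first by apply: leq_ltn_trans lt; rewrite cardsU leq_subr.
move=> x y exy xX yX; have := AB (x, y); rewrite !inE exy xX yX => /(_ isT) /=.
by case/orP=> ->; rewrite ?orbT.
Qed.

Definition cut_cover k (X : nat -> nat -> bool) (C : seq (nat * nat)) :=
  (forall x y, x.+1 < k -> y < k -> X x y != X x.+1 y ->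
     ((x, y) \in C) || ((x.+1, y) \in C)) /\
  (forall x y, x < k -> y.+1 < k -> X x y != X x y.+1 ->
     ((x, y) \in C) || ((x, y.+1) \in C)).

Definition no_full_row k (X : nat -> nat -> bool) :=
  forall y, y < k -> exists2 x, x < k & ~~ X x y.

Lemma pigeonhole_bump j k (s : seq nat) :
  size s < k -> exists2 x, x < k & bump j x \notin s.
Proof.
move=> lt; have [/allP sub|/allPn[_ /mapP[x xk ->] xs]] :=
  boolP (all (mem s) [seq bump j x | x <- iota 0 k]).
  have := uniq_leq_size _ sub; rewrite size_map size_iota leqNgt lt.
  by rewrite map_inj_uniq ?iota_uniq => [/(_ isT)//|]; apply/can_inj/bumpK.
by exists x => //; move: xk; rewrite mem_iota.
Qed.

Lemma pigeonhole_nat k (s : seq nat) :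
  size s < k -> exists2 x, x < k & x \notin s.
Proof.
move=> /(pigeonhole_bump k)[x xk xs]; exists x => //.
by move: xs; rewrite /bump leqNgt xk.
Qed.

Lemma nat_interval_const (f : nat -> bool) m n :
  (forall i, m <= i < n -> f i = f i.+1) ->
  forall x y, m <= x <= n -> m <= y <= n -> f x = f y.
Proof.
move=> step.
have fm x : m <= x <= n -> f x = f m.
  elim: x => [|x IH] xmn; first by congr f; lia.
  have [<-//|neq] := eqVneq m x.+1.
  by rewrite -step ?IH //; lia.
by move=> x y /fm-> /fm->.
Qed.

Lemma cut_cover_row k X C y : cut_cover k X C -> y < k -> y \notin map snd C ->
  forall x x', x < k -> x' < k -> X x y = X x' y.
Proof.
move=> [hor _] yk yC; have nC x : (x, y) \notin C.
  by apply: contra yC; apply: (map_f snd).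
move=> x x' xk x'k.
apply: (@nat_interval_const (fun x => X x y) 0 k.-1); try lia.
move=> i ik; apply/eqP/negPn/negP=> /hor.
by rewrite !(negPf (nC _)); lia.
Qed.

Lemma cut_cover_column_from m k X C x : cut_cover k X C -> x < k ->
    (forall y, m <= y -> (x, y) \notin C) ->
  forall y y', m <= y < k -> m <= y' < k -> X x y = X x y'.
Proof.
move=> [_ ver] xk nC y y' yk y'k.
apply: (@nat_interval_const (X x) m k.-1); try lia.
move=> i ik; apply/eqP/negPn/negP=> /ver.
by rewrite !(negPf (nC _ _)); lia.
Qed.

Lemma cut_cover_column k X C x :
    cut_cover k X C -> x < k -> x \notin map fst C ->
  forall y y', y < k -> y' < k -> X x y = X x y'.
Proof.
move=> cC xk xC y y'; apply: (@cut_cover_column_from 0 _ _ C) => // z _.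
by apply: contra xC; apply: (map_f fst).
Qed.

(** [X] is constant along a row that misses the cover, and no row is full. *)
Lemma uncut_row_out k X C y : cut_cover k X C -> no_full_row k X ->
  y < k -> y \notin map snd C -> forall x, x < k -> ~~ X x y.
Proof.
move=> cC nofull yk yC x xk; have [z zk] := nofull _ yk.
by rewrite (cut_cover_row cC yk yC zk xk).
Qed.

Lemma exists_uncut_row k X C :
    cut_cover k X C -> no_full_row k X -> size C < k ->
  exists y, [/\ y < k, y \notin map snd C & forall x, x < k -> ~~ X x y].
Proof.
move=> cC nofull; rewrite -(size_map snd) => /pigeonhole_nat[y yk yC].
by exists y; split=> //; apply: uncut_row_out yC.
Qed.

(** * Deleting a row and a column *)

(* [c0] can be dropped from the cover [C] when row [0] and column [j] are
   deleted from the grid of side [k.+1]: deleting column [j] makes columns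
   [j.-1] and [j.+1] adjacent, and [c0] must not be needed for the new edge.
   A [c0] lying below the grid expresses that [C] already has fewer than [k]
   elements. *)
Definition deletable k (X : nat -> nat -> bool) (C : seq (nat * nat)) j :=
  exists (c0 : nat * nat) (C0 : seq (nat * nat)),
  [/\ size C0 < k, {subset C <= c0 :: C0} &
    (c0.2 = 0 /\ c0 \in C) \/
    (c0.1 = j /\ (c0.2 < k.+1 -> 0 < j -> j < k ->
       (j.-1, c0.2) \notin C -> (j.+1, c0.2) \notin C ->
       X j.-1 c0.2 = X j.+1 c0.2))].

Lemma delete_cut_cover k X C j : cut_cover k.+1 X C -> deletable k X C j ->
  exists2 C', size C' < k & cut_cover k (fun x y => X (bump j x) y.+1) C'.
Proof.
move=> [hor ver] [c0 [C0 [ltk sub c0P]]].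
(* Off column [j], [psi] inverts the reindexing; column [j] goes to the right end of the new
   edges. *)
pose psi (p : nat * nat) := ((if p.1 <= j then p.1 else p.1.-1), p.2.-1).
exists (map psi C0); first by rewrite size_map.
have keep x y : (bump j x, y.+1) \in C -> (x, y) \in map psi C0.
  move=> /sub; rewrite inE => /orP[/eqP eqc|/(map_f psi)].
    by case: c0P => -[]; rewrite -eqc //= => /eqP;
      rewrite eq_sym (negPf (neq_bump _ _)).
  suff -> : psi (bump j x, y.+1) = (x, y) by [].
  by rewrite /psi /bump /=; congr pair; case: ifP; lia.
split=> x y xk yk; last first.
  move=> /ver h.
  have /orP[/keep->//|/keep->] :
      ((bump j x, y.+1) \in C) || ((bump j x, y.+2) \in C).
    by apply: h; rewrite /bump; lia.
  by rewrite orbT.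
have [eqj|neqj] := eqVneq x.+1 j; last first.
  have -> : bump j x.+1 = (bump j x).+1 by rewrite /bump; lia.
  move=> /hor h.
  have /orP[/keep->//|] :
      ((bump j x, y.+1) \in C) || (((bump j x).+1, y.+1) \in C).
    by apply: h; rewrite /bump; lia.
  have -> : (bump j x).+1 = bump j x.+1 by rewrite /bump; lia.
  by move=> /keep->; rewrite orbT.
have [bx bx1] : bump j x = j.-1 /\ bump j x.+1 = j.+1 by rewrite /bump; lia.
have [/keep->//|nx] := boolP ((bump j x, y.+1) \in C).
have [/keep->|nx1] := boolP ((bump j x.+1, y.+1) \in C); first by rewrite orbT.
move: nx nx1; rewrite bx bx1 => nx nx1 neq.
(* The uncovered ends of the new edge lie on different sides of [X], so one of them is separated
   from the deleted vertex between them. *)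
have jC : (j, y.+1) \in C.
  have [eq1|neq1] := eqVneq (X j.-1 y.+1) (X j y.+1).
    by have := hor j y.+1; rewrite (negPf nx1) orbF -eq1; apply=> //; lia.
  by have := hor j.-1 y.+1; rewrite (negPf nx) prednK //; try lia;
    apply=> //; lia.
move/sub: (jC); rewrite inE => /orP[/eqP eqc|/(map_f psi) jC0].
  case: c0P => -[]; rewrite -eqc //= => _ h.
  by case/eqP: neq; apply: h => //; lia.
suff <- : psi (j, y.+1) = (x.+1, y) by rewrite jC0 orbT.
by rewrite /psi /= leqnn eqj.
Qed.

(** Some remaining column meets the cover at most in [c0], and then only in row [0]. Below that [X]
    is constant on it, so a full row would contradict an uncut row, which lies outside [X]. *)
Lemma delete_no_full_row k X C j : cut_cover k.+1 X C -> size C < k.+1 ->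
    no_full_row k.+1 X -> deletable k X C j ->
  no_full_row k (fun x y => X (bump j x) y.+1).
Proof.
move=> cC ltC nofull [c0 [C0 [ltk sub c0P]]] r rk.
have [/hasP[x]|/hasPn full] :=
  boolP (has (fun x => ~~ X (bump j x) r.+1) (iota 0 k)).
  by rewrite mem_iota => xk Xx; exists x.
have [x xk xC] : exists2 x, x < k & bump j x \notin map fst C0.
  by apply: pigeonhole_bump; rewrite size_map.
have Xr : X (bump j x) r.+1 by apply/negPn/full; rewrite mem_iota.
have [y0 [y0k y0C out]] := exists_uncut_row cC nofull ltC.
have bk : bump j x < k.+1 by rewrite /bump; lia.
have nC y : (bump j x, y) \in C -> (bump j x, y) = c0.
  move/sub; rewrite inE => /orP[/eqP//|/(map_f fst)] /=.
  by rewrite (negPf xC).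
case/negP: (out _ bk); case: c0P => [[c02 c0C]|[c01 _]].
  have y0pos : 0 < y0.
    by rewrite lt0n; apply: contraNneq y0C => ->; rewrite -c02; apply: map_f.
  suff <- : X (bump j x) r.+1 = X (bump j x) y0 by [].
  apply: (@cut_cover_column_from 1 _ _ _ _ cC bk); [|lia|lia].
  move=> y ypos; apply/negP=> /nC eqc.
  by move: c02 ypos; rewrite -eqc /= => ->.
suff <- : X (bump j x) r.+1 = X (bump j x) y0 by [].
apply: (@cut_cover_column_from 0 _ _ _ _ cC bk); [|lia|lia].
move=> y _; apply/negP=> /nC eqc; move: c01; rewrite -eqc /= => /eqP.
by rewrite eq_sym (negPf (neq_bump _ _)).
Qed.

(* If the cover misses row [0], a topmost element of it is deletable together
   with its column: everything above lies outside [X]. *)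
Lemma exists_deletable k X C : cut_cover k.+1 X C -> no_full_row k.+1 X ->
    size C < k.+1 -> 0 < k ->
  (forall j, deletable k X C j) \/
  (exists2 j, deletable k X C j & forall x, x < k.+1 -> ~~ X x 0).
Proof.
move=> cC nofull ltC kpos.
have rem_small c : c \in C -> size (rem c C) < k /\ {subset C <= c :: rem c C}.
  move=> cinC; split; last by move=> p; rewrite (perm_mem (perm_to_rem cinC)).
  by rewrite size_rem //; case: (C) cinC ltC => //= *; lia.
have [/mapP[c cinC c2]|top] := boolP (0 \in map snd C).
  left=> j; have [lt sub] := rem_small _ cinC.
  by exists c, (rem c C); split=> //; left.
case: C => [|c1 C'] in cC ltC top rem_small *.
  by left=> j; exists (j, k.+1), [::]; split=> //; right; split=> //=;
    rewrite ltnn.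
set C := c1 :: C' in cC ltC top rem_small *; right.
have exC : exists y, y \in map snd C by exists c1.2; rewrite inE eqxx.
case: (ex_minnP exC) => y /mapP[c cinC ->] cmin.
have [lt sub] := rem_small _ cinC.
exists c.1; last exact: uncut_row_out cC nofull _ top.
exists c, (rem c C); split=> //; right; split=> // ck jpos jk nl nr.
have cpos : 0 < c.2.
  by rewrite lt0n; apply: contraNneq top => <-; apply: map_f.
have lt_pred : c.2.-1 < c.2 by rewrite ltn_predL.
have aboveC x : (x, c.2.-1) \notin C.
  by apply/negP=> /(map_f snd)/cmin; rewrite leqNgt lt_pred.
have above x : x < k.+1 -> ~~ X x c.2.-1.
  move=> xk; apply: (uncut_row_out cC nofull _ _ xk); first exact: ltn_trans ck.
  by apply/negP=> /cmin; rewrite leqNgt lt_pred.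
(* The vertex above is outside [X] and uncovered, so an uncovered vertex in the row of [c] is
   outside too. *)
have out x : x < k.+1 -> (x, c.2) \notin C -> X x c.2 = false.
  move=> xk xC; apply/negP=> Xx; have := cC.2 x c.2.-1 xk.
  rewrite prednK // Xx (negPf (above _ xk)) (negPf (aboveC x)) (negPf xC).
  by move=> /(_ ck isT).
by rewrite !out //; lia.
Qed.

(** At most one set prescribes the column to delete, unless two of them miss row [0]; then a vertex
    of that row outside the third is the witness. *)
Lemma three_small_not_cover k X1 X2 X3 C1 C2 C3 :
    cut_cover k X1 C1 -> cut_cover k X2 C2 -> cut_cover k X3 C3 ->
    size C1 < k -> size C2 < k -> size C3 < k ->
    no_full_row k X1 -> no_full_row k X2 -> no_full_row k X3 ->
  exists x y, [/\ x < k, y < k & ~~ [|| X1 x y, X2 x y | X3 x y]].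
Proof.
elim: k X1 X2 X3 C1 C2 C3 => // k IH X1 X2 X3 C1 C2 C3.
move=> c1 c2 c3 l1 l2 l3 n1 n2 n3.
have [k0|kpos] := posnP k.
  rewrite k0 in n1 n2 n3 *; exists 0, 0; split=> //.
  have [[|//] _ /negPf->] := n1 0 isT; have [[|//] _ /negPf->] := n2 0 isT.
  by have [[|//] _ /negPf->] := n3 0 isT.
have step j :
    deletable k X1 C1 j -> deletable k X2 C2 j -> deletable k X3 C3 j ->
    exists x y, [/\ x < k.+1, y < k.+1 & ~~ [|| X1 x y, X2 x y | X3 x y]].
  move=> d1 d2 d3.
  have [C1' l1' c1'] := delete_cut_cover c1 d1.
  have [C2' l2' c2'] := delete_cut_cover c2 d2.
  have [C3' l3' c3'] := delete_cut_cover c3 d3.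
  have n1' := delete_no_full_row c1 l1 n1 d1.
  have n2' := delete_no_full_row c2 l2 n2 d2.
  have n3' := delete_no_full_row c3 l3 n3 d3.
  have [x [y [xk yk nX]]] := IH _ _ _ _ _ _ c1' c2' c3' l1' l2' l3' n1' n2' n3'.
  by exists (bump j x), y.+1; split=> //; rewrite /bump; lia.
case: (exists_deletable c1 n1 l1 kpos) (exists_deletable c2 n2 l2 kpos)
  (exists_deletable c3 n3 l3 kpos)
  => [d1|[j1 d1 o1]] [d2|[j2 d2 o2]] [d3|[j3 d3 o3]].
- exact: (step 0).
- exact: (step j3).
- exact: (step j2).
- have [x xk /negPf Xx] := n1 0 isT; exists x, 0; split=> //.
  by rewrite Xx (negPf (o2 _ _)) // (negPf (o3 _ _)).
- exact: (step j1).
- have [x xk /negPf Xx] := n2 0 isT; exists x, 0; split=> //.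
  by rewrite Xx (negPf (o1 _ _)) // (negPf (o3 _ _)).
- have [x xk /negPf Xx] := n3 0 isT; exists x, 0; split=> //.
  by rewrite Xx (negPf (o1 _ _)) // (negPf (o2 _ _)).
- have [x xk /negPf Xx] := n3 0 isT; exists x, 0; split=> //.
  by rewrite Xx (negPf (o1 _ _)) // (negPf (o2 _ _)).
Qed.

(** * Transfer to the finite grid *)

Section GridSets.
Variable k : nat.
Implicit Type S : {set grid_vertex k}.

Definition coord_pred S x y :=
  [exists v in S, (val v.1 == x) && (val v.2 == y)].

Lemma coord_predE S (v : grid_vertex k) :
  coord_pred S (val v.1) (val v.2) = (v \in S).
Proof.
apply/exists_inP/idP=> [[w wS /andP[/eqP/val_inj e1 /eqP/val_inj e2]]|vS].
  by rewrite [v]surjective_pairing -e1 -e2 -surjective_pairing.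
by exists v; rewrite ?eqxx.
Qed.

Lemma grid_adj_sym (u v : grid_vertex k) : grid_adj u v = grid_adj v u.
Proof. rewrite /grid_adj; lia. Qed.

Lemma mm_setC S : mm (~: S) = mm S.
Proof.
rewrite /mm /max_cut_matching; suff -> : cut_edges (@grid_adj k) (~: S) =
  cut_edges (@grid_adj k) S by [].
apply/setP=> A; apply/imsetP/imsetP=> -[[u v]]; rewrite !inE /= ?negbK.
  case/and3P=> uv uS vS ->; exists (v, u); rewrite /= 1?setUC //.
  by rewrite inE /= grid_adj_sym uv uS vS.
case/and3P=> uv uS vS ->; exists (v, u); rewrite /= 1?setUC //.
by rewrite !inE /= negbK grid_adj_sym uv uS vS.
Qed.

Lemma mm_cut_cover S : mm S < k ->
  exists2 C, size C < k & cut_cover k (coord_pred S) C.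
Proof.
move=> /max_cut_matching_cover[C ltC cC].
pose toN (v : grid_vertex k) := (val v.1, val v.2).
exists [seq toN v | v <- enum C]; first by rewrite size_map -cardE.
have cov (u v : grid_vertex k) : grid_adj u v ->
    coord_pred S (val u.1) (val u.2) != coord_pred S (val v.1) (val v.2) ->
    (toN u \in [seq toN v | v <- enum C]) ||
    (toN v \in [seq toN v | v <- enum C]).
  rewrite !coord_predE => uv neq.
  suff /orP[uC|vC] : (u \in C) || (v \in C).
  - by rewrite map_f ?mem_enum.
  - by rewrite orbC map_f ?mem_enum.
  case: (boolP (u \in S)) (boolP (v \in S)) neq => [uS|uS] [vS|vS] // _.
    exact: cC.
  by rewrite orbC; apply: cC; rewrite // grid_adj_sym.
split=> x y xk yk.
- by apply: (cov (Ordinal (ltnW xk), Ordinal yk) (Ordinal xk, Ordinal yk));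
    rewrite /grid_adj /=; lia.
- by apply: (cov (Ordinal xk, Ordinal (ltnW yk)) (Ordinal xk, Ordinal yk));
    rewrite /grid_adj /=; lia.
Qed.

Lemma small_cut_cover S : small S ->
  exists2 C, size C < k &
    cut_cover k (coord_pred S) C /\ no_full_row k (coord_pred S).
Proof.
move=> /andP[/mm_cut_cover[C ltC cC] /forallP nofull].
exists C => //; split=> // y yk.
have /subsetPn[v] := nofull (Ordinal yk); rewrite inE => /eqP v2 vS.
exists (val v.1); first exact: ltn_ord.
by rewrite -[y]/(val (Ordinal yk)) -v2 coord_predE.
Qed.

End GridSets.

Theorem lemma4p6 (k : nat) (hk : 2 <= k) :
  tangle (@mm k) k (small_sets k).
Proof.
split=> [S leS | S1 S2 S3 | x].
- have ltS : mm S < k by lia.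
  rewrite !inE /small mm_setC ltS /=.
  case: (boolP [forall j, ~~ (grid_row j \subset S)]) => [_|]; first by left.
  (* With row [i] in [S] and row [j] in the complement, a column missing the cover would meet both
     sides. *)
  move=> /forallPn[i /negPn iS]; right; apply/forallP=> j; apply/negP=> jS.
  have [C ltC cC] := mm_cut_cover ltS.
  have [x xk xC] : exists2 x, x < k & x \notin map fst C.
    by apply: pigeonhole_nat; rewrite size_map.
  have := cut_cover_column cC xk xC (ltn_ord i) (ltn_ord j).
  have Ei := coord_predE S (Ordinal xk, i).
  have Ej := coord_predE S (Ordinal xk, j).
  rewrite /= in Ei Ej; rewrite Ei Ej (subsetP iS) ?inE //.
  by have := subsetP jS (Ordinal xk, j); rewrite !inE eqxx => /(_ isT)/negPf->.
- rewrite !inE => /small_cut_cover[C1 l1 [c1 n1]].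
  move=> /small_cut_cover[C2 l2 [c2 n2]] /small_cut_cover[C3 l3 [c3 n3]].
  have [x [y [xk yk]]] := three_small_not_cover c1 c2 c3 l1 l2 l3 n1 n2 n3.
  have E S := coord_predE S (Ordinal xk, Ordinal yk); rewrite /= in E.
  rewrite !E => nS; apply/eqP=> /setP/(_ (Ordinal xk, Ordinal yk)).
  by rewrite !inE -orbA (negPf nS).
- rewrite inE /small negb_and; apply/orP; right; apply/forallPn.
  (* Since [2 <= k], some row avoids [x]. *)
  have [y yk yx] : exists2 y, y < k & y \notin [:: val x.2].
    by apply: pigeonhole_nat.
  exists (Ordinal yk); apply/negPn/subsetP=> v; rewrite !inE => /eqP v2.
  by apply/negP=> /eqP eqv; move: yx; rewrite inE -eqv v2 eqxx.
Qed.
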